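(* Consider the mixture observable $$M(t)=\sum_{i=1}^N w_i\,\mathcal B_0\bigl(K_{0i}\mathcal S_i(t)\psi_i\bigr),\qquad t\ge0.$$ Assume $\mathcal Y=\mathbb C$ and that the observable is a finite exponential sum $$M(t)=\sum_{\ell=1}^L a_\ell e^{-\mu_\ell t},\qquad \mu_\ell\ne\mu_{\ell'}\ (\ell\ne\ell').$$ Assume spectral separation: $\sigma(A_i)\cap\sigma(A_j)=\varnothing$ for all $i\ne j$. Then the modal tuples $\{(\mu_\ell,a_\ell)\}_{\ell=1}^L$ are uniquely determined by $M$ (up to permutation of the modal pairs). Moreover, for each $\ell$ there exist a unique sector index $i(\ell)$ and a unique eigenvalue $\alpha_\ell\in\sigma_p(A_{i(\ell)})$ such that $\mu_\ell=\alpha_\ell$. Hence the tagged family $\{(i(\ell),\alpha_\ell,a_\ell)\}_{\ell=1}^L$ is uniquely determined by $M$. If, in addition, $\mathcal B_0K_{0i}$ is observable on eigenspaces for each sector $i$ and the weights $\{w_i\}_{i=1}^N$ are known, then each active eigenspace component $P_{i,\alpha}\psi_i$ is uniquely recovered from the coefficient attached to the rate $\alpha$.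
   Context: Setting. $I$ is an index set, whose elements are called sectors. For each $i\in I$: $\mathcal H_i$ is a separable Hilbert space; $A_i$ is a positive self-adjoint operator on $\mathcal H_i$ with compact resolvent, whose spectrum $\sigma(A_i)$ contains at least one strictly positive eigenvalue; $\mathcal S_i(t)=e^{-tA_i}$, $t\ge0$. Bounded injective operators $K_{ij}:\mathcal H_j\to\mathcal H_i$ ($i,j\in I$) and numbers $\lambda_{ij}>0$ satisfy, for all $i,j,k\in I$, $K_{ik}=K_{ij}K_{jk}$ and $K_{ij}\mathcal S_j(t)=\mathcal S_i(\lambda_{ij}t)K_{ij}$ for all $t\ge0$. Data of the observable. $0$ is a fixed reference sector, $\mathcal B_0:\mathcal H_0\to\mathcal Y$ is a bounded observation operator, and for each $i=1,\dots,N$, $\psi_i\in\mathcal H_i$ and $w_i>0$. Each $A_i$ has an orthonormal eigenbasis $(\phi_{i,n})_{n\ge1}$ with eigenvalues $\alpha_{i,n}>0$, $\alpha_{i,n}\to\infty$. The finite exponential form of $M$ arises when each $\psi_i$ is a finite linear combination of eigenvectors of $A_i$; the rates are then the eigenvalues $\alpha_{i,n}$ involved, after merging equal ones. Notation. $\sigma_p$ is the point spectrum; $E_{i,\alpha}=\ker(A_i-\alpha I)$; $P_{i,\alpha}$ is the orthogonal projection of $\mathcal H_i$ onto $E_{i,\alpha}$. The component $P_{i,\alpha}\psi_i$ (or the pair $(i,\alpha)$) is active if $P_{i,\alpha}\psi_i\ne0$. Standing assumption in the scalar-output case $\mathcal Y=\mathbb C$: all active eigenvalues are simple, i.e. $\dim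 E_{i,\alpha}=1$ for each active $(i,\alpha)$. Definition. $\mathcal B_0K_{0i}$ is observable on eigenspaces if $\mathcal B_0K_{0i}|_{E_{i,\alpha}}$ is injective for every $\alpha\in\sigma_p(A_i)$.
   Formalization: The coefficients a_ℓ are required to be nonzero, in the given and in every competing exponential sum, since a term with a_ℓ = 0 can carry any rate and the modal tuples would then not be determined by M. *)

(* Defs.v *)
From HB Require Import structures.
From mathcomp Require Import all_boot all_order all_algebra.
From mathcomp Require Import complex.
From mathcomp Require Import all_classical all_reals all_analysis.

Set Implicit Arguments.
Unset Strict Implicit.
Unset Printing Implicit Defensive.

Import Order.TTheory GRing.Theory Num.Theory.
Import numFieldNormedType.Exports.

Local Open Scope classical_set_scope.
Local Open Scope complex_scope.
Local Open Scope ring_scope.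

(* A complex Hilbert space is a complete normed module over R[i] together with
   a positive definite Hermitian form (linear in its first argument) that
   induces its norm. *)
Definition induces_norm (R : realType) (H : completeNormedModType R[i])
    (ip : {dot H for Num.conj}) : Prop :=
  forall x : H, ip x x = `|x| ^+ 2.

Definition separable_space (T : topologicalType) : Prop :=
  exists2 D : set T, countable D & dense D.

Definition bounded_op (R : realType) (V W : normedModType R[i]) (f : V -> W) :
    Prop :=
  exists M : R[i], forall x : V, `|f x| <= M * `|x|.

Definition compact_op (R : realType) (V W : normedModType R[i]) (f : V -> W) :
    Prop :=
  precompact (f @` [set x : V | `|x| <= 1]).

(* The values of [opfun] outside [opdom] are irrelevant: no definition below
   looks at them. *)
Record unbounded_op (R : realType) (H : normedModType R[i]) := UnboundedOp {
  opdom : set H ;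
  opfun :> H -> H }.

Section UnboundedOperators.
Variables (R : realType) (H : completeNormedModType R[i]).
Variables (ip : {dot H for Num.conj}) (A : unbounded_op H).

Definition linear_op : Prop :=
  opdom A 0 /\
  forall (c : R[i]) (x y : H), opdom A x -> opdom A y ->
    opdom A (c *: x + y) /\ A (c *: x + y) = c *: A x + A y.

(* [adjoint_graph x z] says that x belongs to the domain of the adjoint A^*
   and that A^* x = z. *)
Definition adjoint_graph (x z : H) : Prop :=
  forall y, opdom A y -> ip (A y) x = ip y z.

Definition self_adjoint : Prop :=
  [/\ linear_op, dense (opdom A) &
      forall x z, adjoint_graph x z <-> opdom A x /\ z = A x].

Definition positive_op : Prop := forall x, opdom A x -> 0 <= ip (A x) x.

(* T = (A - z I)^-1, an everywhere defined bounded operator *)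
Definition is_resolvent (z : R[i]) (T : {linear H -> H}) : Prop :=
  [/\ bounded_op T,
      forall y, opdom A (T y) /\ A (T y) - z *: T y = y &
      forall x, opdom A x -> T (A x - z *: x) = x].

Definition spectrum : set R[i] :=
  [set z | ~ exists T : {linear H -> H}, is_resolvent z T].

Definition compact_resolvent : Prop :=
  exists (z : R[i]) (T : {linear H -> H}), is_resolvent z T /\ compact_op T.

Definition op_eigenspace (z : R[i]) : set H :=
  [set x | opdom A x /\ A x = z *: x].

Definition point_spectrum : set R[i] :=
  [set z | exists2 x, x != 0 & op_eigenspace z x].

Definition orthonormal_basis (phi : nat -> H) : Prop :=
  (forall m n, ip (phi m) (phi n) = (m == n)%:R) /\
  forall x, series (fun n => ip x (phi n) *: phi n) @ \oo --> x.

Definition orthonormal_eigenbasis (phi : nat -> H) (alpha : nat -> R) : Prop :=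
  [/\ orthonormal_basis phi,
      forall n, op_eigenspace (alpha n)%:C (phi n),
      forall n, 0 < alpha n &
      alpha @ \oo --> +oo].

(* Only the values S t for t >= 0 are meaningful. *)
Definition c0_semigroup (S : R -> {linear H -> H}) : Prop :=
  [/\ forall t, 0 <= t -> bounded_op (S t),
      forall x, S 0 x = x,
      forall s t, 0 <= s -> 0 <= t -> forall x, S (s + t) x = S s (S t x) &
      forall x, S t x @[t --> 0^'+] --> x].

(* S t = e^{-tA} for t >= 0: the strongly continuous semigroup whose
   infinitesimal generator, domain included, is -A. *)
Definition exp_semigroup (S : R -> {linear H -> H}) : Prop :=
  c0_semigroup S /\
  forall x y : H,
    ((t^-1)%:C *: (S t x - x) @[t --> 0^'+] --> y) <->
    (opdom A x /\ y = - A x).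

(* Total function: 0 at the points x that have no orthogonal projection on E;
   this does not happen when E is a closed subspace. *)
Definition orthoproj (E : set H) (x : H) : H :=
  xget 0 [set p | E p /\ forall e, E e -> ip (x - p) e = 0].

Definition eigencomponent (z : R[i]) (psi : H) : H :=
  orthoproj (op_eigenspace z) psi.

Definition active (z : R[i]) (psi : H) : Prop := eigencomponent z psi != 0.

Definition simple_eigenvalue (z : R[i]) : Prop :=
  exists2 v : H, v != 0 & op_eigenspace z = [set c *: v | c in [set: R[i]]].

Definition observable_on_eigenspaces (Y : Type) (T : H -> Y) : Prop :=
  forall z, point_spectrum z -> set_inj (op_eigenspace z) T.

End UnboundedOperators.

Definition mixture (R : realType) (I : Type) (H : I -> completeNormedModType R[i])
    (K : forall i j : I, {linear H j -> H i})
    (S : forall i : I, R -> {linear H i -> H i}) (o : I)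
    (B0 : {linear H o -> R[i]^o}) (N : nat) (sec : 'I_N -> I)
    (w : 'I_N -> R) (psi : forall k : 'I_N, H (sec k)) (t : R) : R[i] :=
  \sum_(k < N) (w k)%:C * B0 (K o (sec k) (S (sec k) t (psi k))).

(* M(t) = sum_l a_l e^{- mu_l t} for t >= 0, with distinct rates.  Modal
   coefficients are nonzero: a zero term can carry an arbitrary rate, and no
   function would determine its modal pairs. *)
Definition finite_exp_sum (R : realType) (M : R -> R[i]) (L : nat)
    (mu : 'I_L -> R) (a : 'I_L -> R[i]) : Prop :=
  [/\ injective mu, forall l, a l != 0 &
      forall t : R, 0 <= t -> M t = \sum_(l < L) a l * (expR (- mu l * t))%:C].

(* Equality up to a permutation of the indices. *)
Definition same_family (T : Type) (L L' : nat) (f : 'I_L -> T) (g : 'I_L' -> T) :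
    Prop :=
  exists2 s : 'I_L -> 'I_L', bijective s & forall l, g (s l) = f l.

(* Main.v *)
Require Import Defs.
From HB Require Import structures.
From mathcomp Require Import all_boot all_order all_algebra.
From mathcomp Require Import complex.
From mathcomp Require Import all_classical all_reals all_analysis.
From mathcomp Require Import ring lra.

(* Expand each psi_k in the eigenbasis and let gamma be any real number. The
   finitely many modes with alpha_{k,n} < gamma contribute a finite exponential
   sum to M, and by orthonormality the rest of M is O(e^{-gamma t}). A finite
   exponential sum that is O(e^{-gamma t}) has zero total coefficient at every
   rate beta < gamma (divide by the slowest exponential and let t tend to
   infinity). Comparing with the given form of M yields, for every real beta,
   sum_k w_k B_0 K_{0k} P_{k,beta} psi_k = sum_{l | mu_l = beta} a_l,
   and spectral separation leaves at most one nonzero term on the left.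
   That e^{-tA} acts on an active (hence simple) eigenvector as a scalar
   e^{-alpha t} follows because it preserves the eigenline, and a
   multiplicative g with g(h) = 1 - alpha h + o(h) is e^{-alpha t}. *)

Set Implicit Arguments.
Unset Strict Implicit.
Unset Printing Implicit Defensive.

Import Order.TTheory GRing.Theory Num.Theory.
Import numFieldNormedType.Exports.

Local Open Scope classical_set_scope.
Local Open Scope complex_scope.
Local Open Scope ring_scope.

(** * Real scalars inside [R[i]] and bounded operators *)

Section Preliminaries.
Variable R : realType.

Lemma ge0_complexE (x : R[i]) : 0 <= x -> x = (complex.Re x)%:C.
Proof. by case: x => a b; rewrite lecE /= => /andP[/eqP -> _]. Qed.

Lemma realc_ge0 (x : R) : (0 <= x%:C) = (0 <= x).
Proof. exact: lecR. Qed.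

Lemma normc_RRe (x : R[i]) : `|x| = (complex.Re `|x|)%:C.
Proof. exact: ge0_complexE. Qed.

Lemma realc_conj (x : R) : Num.conj x%:C = x%:C :> R[i].
Proof. by apply/eqP; rewrite eq_complex /= oppr0 !eqxx. Qed.

(** The bound in [bounded_op] is a complex number [M]. Any [x != 0] forces [0 <= M], so the modulus
    of [M] is a real bound that also covers [x = 0]. *)
Lemma bounded_opP (V W : normedModType R[i]) (f : V -> W) : bounded_op f ->
  exists2 C : R, 0 <= C & forall x, `|f x| <= C%:C * `|x|.
Proof.
move=> [M fM]; exists (complex.Re `|M|) => [|x].
  by rewrite -realc_ge0 -normc_RRe.
rewrite -normc_RRe; have := fM x; have [-> |x0] := eqVneq x 0.
  by rewrite !normr0 !mulr0.
have Mx : 0 <= M * `|x| := le_trans (normr_ge0 _) (fM x).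
move=> /le_trans; apply; rewrite ler_wpM2r // ger0_norm //.
by rewrite pmulr_lge0 // normr_gt0 in Mx.
Qed.

Lemma bounded_op_cvg (V W : normedModType R[i]) (f : {linear V -> W})
    (T : Type) (F : set_system T) {FF : Filter F} (u : T -> V) (x : V) :
  bounded_op f -> u t @[t --> F] --> x -> f (u t) @[t --> F] --> f x.
Proof.
move=> /bounded_opP[C C0 fC] /cvgrPdist_le ux; apply/cvgrPdist_le => e e0.
(* [C] may vanish, and [e] is about to be divided by the constant; hence [C + 1]. *)
have C1 : 0 < (C + 1)%:C :> R[i] by rewrite ltcR ltr_wpDl.
near=> t; rewrite -linearB.
apply: (le_trans (fC _)); apply: (@le_trans _ _ ((C + 1)%:C * (e / (C + 1)%:C))).
  apply: ler_pM; rewrite ?realc_ge0 ?lecR ?lerDl //.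
  by near: t; apply: ux; rewrite divr_gt0.
by rewrite mulrC divfK // gt_eqF.
Unshelve. all: by end_near.
Qed.

End Preliminaries.

(** * Linear independence of exponentials modulo a decaying error *)

Section FiniteExponentialSums.
Variable R : realType.

Lemma expRcD (x y : R) : (expR (x + y))%:C = (expR x)%:C * (expR y)%:C.
Proof. by rewrite expRD rmorphM. Qed.

Lemma cvgr_expRM (d : R) : 0 < d -> expR (- d * t) @[t --> +oo] --> 0.
Proof.
move=> d0; under eq_fun do rewrite mulNr.
apply: (@cvg_comp _ _ _ (fun t => d * t) (fun x => expR (- x)) +oo +oo).
  exact: gt0_cvgMry.
exact: cvgr_expR.
Qed.

(** Induction on the number of terms: the slowest rate below [gamma] is shown to have total
    coefficient zero, and all its terms are then discarded. Rates may coincide, so only the total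
    coefficient at a rate can be expected to vanish. *)
Lemma expsum_coef_eq0 (J : finType) (P : pred J) (c : J -> R[i]) (nu : J -> R)
    (C gamma : R) :
  (forall t, 0 <= t ->
    `|\sum_(j | P j) c j * (expR (- nu j * t))%:C|
      <= (C * expR (- gamma * t))%:C) ->
  forall beta, beta < gamma -> \sum_(j | P j && (nu j == beta)) c j = 0.
Proof.
have [n] := ubnP #|P|; elim: n P => // n IHn P ltPn sumP beta ltbg.
have [j1 /andP[Pj1 ltj1]|noP] := pickP (fun j => P j && (nu j < gamma)); last first.
  rewrite big1 // => j /andP[Pj /eqP jb]; have := noP j.
  by rewrite /= Pj jb ltbg.
have [j0 Pj0 min_j0] := arg_minP nu Pj1.
have lt0g : nu j0 < gamma by apply: le_lt_trans ltj1; exact: min_j0.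
set c0 := \sum_(j | P j && (nu j == nu j0)) c j.
have splitP t : \sum_(j | P j) c j * (expR (- nu j * t))%:C =
    c0 * (expR (- nu j0 * t))%:C +
    \sum_(j | P j && (nu j != nu j0)) c j * (expR (- nu j * t))%:C.
  rewrite (bigID (fun j => nu j == nu j0)) /= mulr_suml; congr (_ + _).
  by apply: eq_bigr => j /andP[_ /eqP ->].
have c00 : c0 = 0.
  apply/eqP; rewrite -normr_le0 normc_RRe (_ : 0 = 0%:C) // lecR.
  (* [F t] bounds [|c0|] after multiplication by the exponential of [nu j0 * t]. All exponents left
     are strictly negative multiples of [t], because [nu j0] is minimal and below [gamma]. *)
  pose F (t : R) := C * expR (- (gamma - nu j0) * t) +
    \sum_(j | P j && (nu j != nu j0))
       complex.Re `|c j| * expR (- (nu j - nu j0) * t).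
  have F0 : F t @[t --> +oo] --> 0.
    rewrite -[0]addr0; apply: cvgD.
      rewrite -(mulr0 C); apply: cvgM; first exact: cvg_cst.
      by apply: cvgr_expRM; rewrite subr_gt0.
    rewrite [X in _ --> X](_ : 0 = \sum_(j | P j && (nu j != nu j0)) 0); last by rewrite big1.
    apply: (@cvg_big R J _ 0 _ (@add_continuous R) R +oo _
      (fun j t => complex.Re `|c j| * expR (- (nu j - nu j0) * t)) (fun=> 0)) => j /andP[Pj neqj].
    rewrite -(mulr0 (complex.Re `|c j|)); apply: cvgM; first exact: cvg_cst.
    by apply: cvgr_expRM; rewrite subr_gt0 lt_neqAle eq_sym neqj min_j0.
  apply: (@ler_cvg_to _ _ _ _ (fun=> complex.Re `|c0|) F _ _ _ F0).
    exact: cvg_cst.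
  near=> t; have t0 : 0 <= t by near: t; exact: nbhs_pinfty_ge.
  rewrite -lecR -normc_RRe.
  have e1 : (expR (- nu j0 * t))%:C * (expR (nu j0 * t))%:C = 1 :> R[i].
    by rewrite -expRcD mulNr addNr expR0.
  have -> : c0 = (expR (nu j0 * t))%:C *
      (\sum_(j | P j) c j * (expR (- nu j * t))%:C -
       \sum_(j | P j && (nu j != nu j0)) c j * (expR (- nu j * t))%:C).
    by rewrite splitP addrK mulrCA [X in c0 * X]mulrC e1 mulr1.
  rewrite normrM ger0_norm; last by rewrite realc_ge0 expR_ge0.
  apply: (le_trans (ler_wpM2l _ (ler_normB _ _))).
    by rewrite realc_ge0 expR_ge0.
  rewrite mulrDr /F rmorphD; apply: lerD.
    apply: (le_trans (ler_wpM2l _ (sumP _ t0))).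
      by rewrite realc_ge0 expR_ge0.
    rewrite -rmorphM lecR mulrCA -expRD le_eqVlt; apply/orP; left; apply/eqP.
    by congr (_ * expR _); ring.
  apply: (le_trans (ler_wpM2l _ (ler_norm_sum _ _ _))).
    by rewrite realc_ge0 expR_ge0.
  rewrite mulr_sumr rmorph_sum ler_sum // => j _.
  rewrite normrM [X in _ * (_ * X)]ger0_norm; last first.
    by rewrite realc_ge0 expR_ge0.
  rewrite normc_RRe -!rmorphM lecR mulrCA -expRD le_eqVlt.
  by apply/orP; left; apply/eqP; congr (_ * expR _); ring.
(* A rate other than [nu j0] keeps all its terms when those at [nu j0] are removed, so the induction
   hypothesis applies to it. *)
have [-> //|neqb] := eqVneq beta (nu j0).
rewrite -[RHS](IHn (fun j => P j && (nu j != nu j0)) _ _ beta ltbg).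
- apply: eq_bigl => j; case: (P j) => //=.
  by have [-> |//] := eqVneq (nu j) beta; rewrite ?neqb // andbF.
- rewrite -ltnS; apply: leq_trans ltPn; rewrite ltnS; apply: proper_card.
  apply/properP; split; first by apply/fintype.subsetP => j /andP[].
  by exists j0; rewrite /in_mem /= ?Pj0 ?eqxx.
- by move=> t t0; have := sumP t t0; rewrite splitP c00 mul0r add0r.
Unshelve. all: by end_near.
Qed.
End FiniteExponentialSums.

(** * Multiplicative functions differentiable at zero *)

Section Multiplicative.
Variable R : realType.

(** In the factorization of [x ^+ n - y ^+ n] by [x - y], the cofactor is a sum of [n] monomials of
    modulus at most 1. *)
Lemma norm_subXX_le (F : numFieldType) (x y : F) n : `|x| <= 1 -> `|y| <= 1 ->
  `|x ^+ n - y ^+ n| <= n%:R * `|x - y|.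
Proof.
move=> x1 y1; rewrite subrXX normrM mulrC ler_wpM2r //.
apply: (le_trans (ler_norm_sum _ _ _)).
rewrite -[leRHS]mulr1 mulr_natl -[n in leRHS]card_ord -sumr_const ler_sum // => i _.
by rewrite normrM !normrX mulr_ile1 ?exprn_ge0 ?exprn_ile1.
Qed.

(** Squeeze [1 - x <= expR (- x) <= 1 / (1 + x)]: the outer terms differ by [x ^+ 2 / (1 + x)]. *)
Lemma expRN_approx (x : R) : 0 <= x -> `|expR (- x) - (1 - x)| <= x ^+ 2.
Proof.
move=> x0; rewrite ger0_norm; last by rewrite subr_ge0 expR_ge1Dx.
have e1 : expR (- x) * (1 + x) <= 1.
  by rewrite -[leRHS](expRxMexpNx_1 x) mulrC ler_wpM2r ?expR_ge0 ?expR_ge1Dx.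
have x1 : 0 < 1 + x by rewrite ltr_pwDl.
rewrite -(ler_pM2r x1); apply: (@le_trans _ _ (1 - (1 - x) * (1 + x))); first by nra.
by nra.
Qed.

(** With [t = n * h], both sides are [n]-th powers, of [g h] and of [expR (- (a * h))]. These bases
    differ by at most [2 * eps * h], so the powers differ by at most [2 * t * eps]. *)
Lemma multiplicative_eq_expR (g : R -> R[i]) (a : R) : 0 < a ->
  g 0 = 1 -> (forall s t, 0 <= s -> 0 <= t -> g (s + t) = g s * g t) ->
  (forall eps, 0 < eps -> exists2 d, 0 < d &
    forall h, 0 < h -> h < d -> `|g h - (1 - a * h)%:C| <= (eps * h)%:C) ->
  forall t, 0 <= t -> g t = (expR (- a * t))%:C.
Proof.
move=> a0 g0 gD g'0 t; rewrite le_eqVlt => /predU1P[<-|t0].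
  by rewrite g0 mulr0 expR0.
have gX h n : 0 <= h -> g (n%:R * h) = g h ^+ n.
  move=> h0; elim: n => [|n IHn]; first by rewrite mul0r g0 expr0.
  by rewrite -natr1 mulrDl mul1r gD ?mulr_ge0 // IHn exprSr.
apply/eqP; rewrite -subr_eq0 -normr_le0 normc_RRe (_ : 0 = 0%:C) // lecR.
apply/ler_addgt0Pr => e e0; rewrite add0r.
(* The bound [eps <= a] gives [|g h| <= 1]; the other bound makes the final error [2 * t * eps] at
   most [e]. *)
pose eps := Num.min a (e / (2 * t)).
have eps0 : 0 < eps by rewrite lt_min a0 divr_gt0 // mulr_gt0.
have [d d0 gd] := g'0 _ eps0.
(* So large that [h = t / n] satisfies [h < d], [a * h <= 1] and [(a * h) ^+ 2 <= eps * h]. *)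
pose n := (Num.truncn (t / Num.min d (Num.min (a^-1) (eps / a ^+ 2)))).+1.
have m0 : 0 < Num.min d (Num.min (a^-1) (eps / a ^+ 2)).
  by rewrite !lt_min d0 invr_gt0 a0 divr_gt0 // exprn_gt0.
have n0 : 0 < n%:R :> R by rewrite ltr0n.
pose h := t / n%:R.
have h0 : 0 < h by rewrite divr_gt0.
have : h < Num.min d (Num.min (a^-1) (eps / a ^+ 2)).
  by rewrite ltr_pdivrMr // mulrC -ltr_pdivrMr // truncnS_gt.
rewrite !lt_min => /and3P[hd ha heps].
have ah1 : a * h <= 1 by rewrite mulrC -ler_pdivlMr // mul1r ltW.
have epsa : eps <= a by rewrite ge_min lexx.
have {heps}heps : (a * h) ^+ 2 <= eps * h.
  rewrite exprMn [h ^+ 2]expr2 mulrA ler_wpM2r ?(ltW h0)//.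
  by rewrite mulrC -ler_pdivlMr ?exprn_gt0 // ltW.
have th : t = n%:R * h by rewrite mulrC divfK // gt_eqF.
have e2t : 2 * t * eps <= e.
  by rewrite mulrC -ler_pdivlMr ?mulr_gt0 // ge_min lexx orbT.
rewrite -lecR -normc_RRe; apply: (@le_trans _ _ (2 * t * eps)%:C); last by rewrite lecR.
have -> : (expR (- a * t))%:C = ((expR (- (a * h)))%:C ^+ n : R[i]).
  by rewrite -rmorphXn /= -expRM_natl th; congr (expR _)%:C; ring.
rewrite {1}th (gX _ _ (ltW h0)).
have nc (x : R) : `|x%:C| = `|x|%:C :> R[i].
  by rewrite normc_def /= expr0n addr0 sqrtr_sqr.
have xd := gd _ h0 hd.
have x1 : `|g h| <= 1.
  rewrite -[g h](subrK (1 - a * h)%:C).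
  apply: (le_trans (ler_normD _ _)); apply: (le_trans (lerD xd (lexx _))).
  rewrite nc -rmorphD (_ : 1 = 1%:C) // lecR ger0_norm ?subr_ge0 //.
  by nra.
have y1 : `|(expR (- (a * h)))%:C| <= 1 :> R[i].
  rewrite nc (_ : 1 = 1%:C) // lecR ger0_norm ?expR_ge0 // -expR0 ler_expR.
  by rewrite oppr_le0 mulr_ge0 ?ltW.
apply: (le_trans (norm_subXX_le _ x1 y1)).
have -> : 2 * t * eps = n%:R * (eps * h + eps * h) by rewrite th; ring.
rewrite rmorphM rmorph_nat ler_wpM2l ?ler0n //.
rewrite -[g h](subrK (1 - a * h)%:C) -addrA.
apply: (le_trans (ler_normD _ _)); rewrite [leRHS]rmorphD lerD //.
rewrite -rmorphB nc lecR distrC (le_trans (expRN_approx _)) //.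
by rewrite mulr_ge0 ?ltW.
Qed.
End Multiplicative.

(** * One sector: eigenspaces and expansion in the eigenbasis *)

Section Sector.
Variables (R : realType) (H : completeNormedModType R[i]).
Variables (ip : {dot H for Num.conj}) (A : unbounded_op H).
Variables (S : R -> {linear H -> H}) (phi : nat -> H) (alpha : nat -> R).
Hypothesis ip_norm : induces_norm ip.
Hypothesis selfA : self_adjoint ip A.
Hypothesis expS : exp_semigroup A S.
Hypothesis basis : orthonormal_eigenbasis ip A phi alpha.

Local Notation E := (op_eigenspace A).

Lemma eigenspace0 z : E z 0.
Proof.
have [[d0 linA] _ _] := selfA; split => //.
have [_] := linA 1 0 0 d0 d0; rewrite !scale1r addr0 scaler0 => e.
by apply: (addrI (A 0)); rewrite addr0 -e.
Qed.

Lemma eigenspaceP z c x y : E z x -> E z y -> E z (c *: x + y).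
Proof.
have [[_ linA] _ _] := selfA; move=> [dx ex] [dy ey].
have [d e] := linA c x y dx dy; split => //.
by rewrite e ex ey scalerDr !scalerA mulrC.
Qed.

Lemma eigenspaceZ z c x : E z x -> E z (c *: x).
Proof. by move=> Ex; rewrite -[_ *: _]addr0; apply/eigenspaceP/eigenspace0. Qed.

Lemma eigenspaceB z x y : E z x -> E z y -> E z (x - y).
Proof. by move=> Ex Ey; rewrite addrC -scaleN1r; apply: eigenspaceP. Qed.

Lemma eigenspace_sum z (J : finType) (P : pred J) (F : J -> H) :
  (forall j, P j -> E z (F j)) -> E z (\sum_(j | P j) F j).
Proof.
move=> EF; apply: big_ind => //; first exact: eigenspace0.
by move=> x y Ex Ey; rewrite -[x]scale1r; apply: eigenspaceP.
Qed.

(** Moving [A] across the form gives [z * ip x y = b * ip x y]; being real, [b] leaves the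
    conjugate-linear argument unchanged. *)
Lemma eigenspace_orthogonal z (b : R) x y : z != b%:C -> E z x -> E b%:C y ->
  ip x y = 0.
Proof.
have [_ _ adjA] := selfA; move=> zb [dx ex] [dy ey].
have := (adjA y (A y)).2 (conj dy erefl) x dx.
rewrite ex ey linearZl_LR linearZr_LR /= => /eqP.
rewrite realc_conj -subr_eq0 -mulrBl mulf_eq0 subr_eq0 (negbTE zb) /=.
by move/eqP.
Qed.

Lemma phiE n : E (alpha n)%:C (phi n). Proof. by have [] := basis. Qed.

Lemma alpha_gt0 n : 0 < alpha n. Proof. by have [] := basis. Qed.

Lemma orthonormal m n : ip (phi m) (phi n) = (m == n)%:R.
Proof. by have [[]] := basis. Qed.

Lemma alpha_ge_near gamma : exists m, forall n, (m <= n)%N -> gamma <= alpha n.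
Proof.
have [_ _ _ /cvgryPge/(_ gamma)[m _ Pm]] := basis.
by exists m => n mn; apply: Pm.
Qed.

Lemma coef_eigenspace z x n : E z x -> z != (alpha n)%:C -> ip x (phi n) = 0.
Proof. by move=> Ex zn; apply: (eigenspace_orthogonal zn Ex (phiE n)). Qed.

Lemma finite_expansion m x : (forall n, (m <= n)%N -> ip x (phi n) = 0) ->
  x = \sum_(n < m) ip x (phi n) *: phi n.
Proof.
move=> x0; have [[_ /(_ x) cvx] _ _ _] := basis.
apply: (norm_cvg_unique cvx); apply: cvg_near_cst; near=> k.
rewrite /series /= -(big_mkord xpredT (fun n => ip x (phi n) *: phi n)).
rewrite (big_cat_nat (n := m)) //=; last by near: k; exact: nbhs_infty_ge.
rewrite [X in _ + X]big_nat [X in _ + X]big1 ?addr0 // => n /andP[mn _].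
by rewrite x0 // scale0r.
Unshelve. all: by end_near.
Qed.

(** Otherwise all coefficients of [x] vanish, and the empty expansion gives [x = 0]. In particular
    every eigenvalue is real. *)
Lemma nonzero_eigenvalue z x : E z x -> x != 0 ->
  exists2 n, z = (alpha n)%:C & ip x (phi n) != 0.
Proof.
move=> Ex x0; apply: contrapT => noz; move/eqP: x0; apply.
rewrite (@finite_expansion 0%N x) ?big_ord0 // => n _.
apply/eqP; apply: contrapT => xn; apply: noz; exists n; last exact/negP.
by apply/eqP; apply: contrapT => /negP zn; apply/xn/eqP/(coef_eigenspace Ex).
Qed.

Lemma eigenspace_expansion m z x : (forall n, (m <= n)%N -> z != (alpha n)%:C) ->
  E z x -> x = \sum_(n < m | z == (alpha n)%:C) ip x (phi n) *: phi n.
Proof.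
move=> zm Ex; rewrite [LHS](@finite_expansion m) => [|n mn]; last first.
  exact: coef_eigenspace Ex (zm n mn).
rewrite [RHS]big_mkcond; apply: eq_bigr => n _; case: ifPn => // zn.
by rewrite (coef_eigenspace Ex zn) scale0r.
Qed.

(** The finite sum satisfies the defining conditions of the projection, so the default value of
    [orthoproj] is never taken. A cutoff [m] exists for every [z] because [alpha] tends to
    infinity. *)
Lemma eigencomponentE m z x : (forall n, (m <= n)%N -> z != (alpha n)%:C) ->
  eigencomponent ip A z x = \sum_(n < m | z == (alpha n)%:C) ip x (phi n) *: phi n.
Proof.
move=> zm; set p := \sum_(_ < _ | _) _.
have Ep : E z p.
  by apply: eigenspace_sum => n /eqP ->; apply/eigenspaceZ/phiE.
have orthp e : E z e -> ip (x - p) e = 0.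
  move=> Ee; rewrite (eigenspace_expansion zm Ee) linear_sumr big1 // => n zn.
  rewrite linearZr_LR /= linearBl /p linear_sumlz (bigD1 n) //= linearZl_LR /=.
  rewrite orthonormal eqxx mulr1 big1 ?addr0 ?subrr ?mulr0 // => k /andP[_ kn].
  by rewrite linearZl_LR /= orthonormal (inj_eq val_inj) (negbTE kn) mulr0.
apply: xget_unique; first by split.
(* Uniqueness: [q - p] lies in the eigenspace and is orthogonal to it, hence to itself. *)
move=> q [Eq orthq]; apply/eqP; rewrite -subr_eq0 -(dnorm_eq0 ip).
have Eqp : E z (q - p) by apply: eigenspaceB.
have {1}-> : q - p = (x - p) - (x - q) by rewrite opprB [RHS]addrC addrA subrK.
by rewrite linearBl /= orthp // orthq // subrr.
Qed.

Lemma eigencomponent_eigenspace z x : E z (eigencomponent ip A z x).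
Proof.
have [m am] := alpha_ge_near (complex.Re z + 1).
rewrite (@eigencomponentE m) => [|n mn]; last first.
  apply/eqP => zn; have := am n mn.
  by rewrite zn /= leNgt ltrDl ltr01.
by apply: eigenspace_sum => n /eqP ->; apply/eigenspaceZ/phiE.
Qed.

(** Pairing the eigencomponent with [phi n] returns [ip x (phi n)]. This transfers simplicity,
    assumed for active eigenvalues, to every mode that occurs in [x]. *)
Lemma coef_active n x : ip x (phi n) != 0 -> active ip A (alpha n)%:C x.
Proof.
have [m am] := alpha_ge_near (alpha n + 1).
have zm k : (m <= k)%N -> (alpha n)%:C != (alpha k)%:C :> R[i].
  move=> mk; apply/eqP => -[e]; have := am k mk.
  by rewrite e leNgt ltrDl ltr01.
have nm : (n < m)%N by rewrite ltnNge; apply/negP => /zm; rewrite eqxx.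
rewrite /active (eigencomponentE _ zm); apply: contra_neq => e.
have := congr1 (ip^~ (phi n)) e; rewrite /= linear0l linear_sumlz.
rewrite (bigD1 (Ordinal nm)) //= linearZl_LR /= orthonormal eqxx mulr1.
rewrite big1 ?addr0 // => k /andP[_ kn].
rewrite linearZl_LR /= orthonormal (_ : (_ == _) = false) ?mulr0 //.
by apply: contraNF kn => /eqP kn; apply/eqP/val_inj.
Qed.

(** * Action of the semigroup on eigenvectors and decay of the tail *)

Lemma orthonormal_sum_norm m (d : nat -> R[i]) :
  `|\sum_(n < m) d n *: phi n| ^+ 2 = \sum_(n < m) `|d n| ^+ 2.
Proof.
rewrite -ip_norm linear_sumr; apply: eq_bigr => n _.
rewrite linearZr_LR /= linear_sumlz (bigD1 n) //= linearZl_LR /=.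
rewrite orthonormal eqxx mulr1 big1 ?addr0; last first.
  by move=> k kn; rewrite linearZl_LR /= orthonormal (inj_eq val_inj) (negbTE kn) mulr0.
by rewrite normCKC.
Qed.

(** The bounded operator [S s] commutes with the difference quotients of the semigroup, so it
    carries the generator limit at [v] to the one at [S s v]. *)
Lemma semigroup_eigenspace s z v : 0 <= s -> E z v -> E z (S s v).
Proof.
have [[bS _ SD _] genS] := expS; move=> s0 [dv ev].
have cv := (genS v (- A v)).2 (conj dv erefl).
have {}cv : (t^-1)%:C *: (S t (S s v) - S s v) @[t --> 0^'+] --> - (z *: S s v).
  have -> : - (z *: S s v) = S s (- A v) by rewrite [RHS]linearN ev [in RHS]linearZ.
  apply: cvg_trans (bounded_op_cvg (bS s s0) cv); apply: near_eq_cvg.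
  near=> t; rewrite linearZ linearB /=; congr (_ *: (_ - _)).
  have t0 : 0 <= t by near: t; exact: nbhs_right_ge.
  by rewrite -SD // addrC SD.
have [d e] := (genS _ _).1 cv; split => //.
by rewrite -[LHS]opprK -e opprK.
Unshelve. all: by end_near.
Qed.

Lemma semigroup_simple_eigenvector (a : R) v : 0 < a ->
  simple_eigenvalue A a%:C -> E a%:C v ->
  forall t, 0 <= t -> S t v = (expR (- a * t))%:C *: v.
Proof.
move=> a0 [v0 v00 Ev0] Ev t t0.
have [-> | vN0] := eqVneq v 0; first by rewrite linear0 scaler0.
have vv0 : ip v v != 0 by rewrite dnorm_eq0.
have nv0 : 0 < `|v| by rewrite normr_gt0.
(* The eigenspace is an invariant line, so [S s] multiplies [v] by a scalar, which the form reads
   off. *)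
pose g s := ip (S s v) v / ip v v.
have gE s : 0 <= s -> S s v = g s *: v.
  move=> s0; have := semigroup_eigenspace s0 Ev; rewrite Ev0 => -[d _ dv].
  have := Ev; rewrite Ev0 => -[c _ cv].
  have c0 : c != 0 by apply: contraNneq vN0 => c0; rewrite -cv c0 scale0r.
  have Sv : S s v = (d / c) *: v by rewrite -dv -cv scalerA divfK.
  by rewrite {1}Sv /g Sv linearZl_LR /= mulfK.
have [[_ S0 SD _] genS] := expS.
rewrite gE //; congr (_ *: _); move: t t0.
apply: multiplicative_eq_expR => //.
- by rewrite /g S0 divff.
- move=> s t s0 t0; rewrite /g SD // (gE t t0) linearZ /= linearZl_LR /=.
  by rewrite [ip (g t *: v) v]linearZl_LR /= mulfK // -mulrA mulrC.
move=> e e0; have [dv ev] := Ev.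
(* Tolerance [e * |v|] in the generator limit becomes, once [|v|] is cancelled, tolerance [e] for
   the difference quotient of [g]. *)
have /cvgrPdist_le/(_ (e%:C * `|v|)) := (genS v (- A v)).2 (conj dv erefl).
rewrite mulr_gt0 ?ltcR // => /(_ isT)[d /= d0 dP].
exists d => // h h0 hd; have {dP}dP := dP h.
have := dP _ h0; rewrite /ball /= sub0r normrN gtr0_norm // => /(_ hd).
rewrite (gE _ (ltW h0)).
have -> : - A v - (h^-1)%:C *: (g h *: v - v) = (- a%:C - (h^-1)%:C * (g h - 1)) *: v.
  by rewrite ev scalerBl scaleNr -[in RHS]scalerA scalerBl scale1r.
rewrite normrZ ler_pM2r // => dh.
have hN0 : h%:C != 0 :> R[i] by rewrite gt_eqF // ltcR.
have -> : g h - (1 - a * h)%:C = - h%:C * (- a%:C - (h^-1)%:C * (g h - 1)).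
  by rewrite rmorphB rmorphM fmorphV rmorph1; field.
rewrite normrM normrN [X in X * _]ger0_norm ?realc_ge0 ?(ltW h0) //.
by rewrite rmorphM [leRHS]mulrC ler_wpM2l ?realc_ge0 ?(ltW h0).
Qed.

Lemma semigroup_coef psi : (forall z, active ip A z psi -> simple_eigenvalue A z) ->
  forall t n, 0 <= t ->
  S t (ip psi (phi n) *: phi n) = (ip psi (phi n) * (expR (- alpha n * t))%:C) *: phi n.
Proof.
move=> simple_psi t n t0; have [-> | cn] := eqVneq (ip psi (phi n)) 0.
  by rewrite mul0r !scale0r linear0.
rewrite linearZ /= (@semigroup_simple_eigenvector (alpha n)) ?scalerA //.
- exact: alpha_gt0.
- exact/simple_psi/coef_active.
- exact: phiE.
Qed.

(** The decay is proved on finite blocks of modes beyond [m], by Pythagoras, and passes to the whole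
    tail through continuity of [S t] and [f]. *)
Lemma semigroup_expansion_bound (f : {linear H -> R[i]^o}) psi gamma m :
  bounded_op f -> (forall z, active ip A z psi -> simple_eigenvalue A z) ->
  (forall n, (m <= n)%N -> gamma <= alpha n) ->
  exists C : R, forall t, 0 <= t ->
    `|f (S t psi) - \sum_(n < m) ip psi (phi n) * f (phi n) * (expR (- alpha n * t))%:C|
      <= (C * expR (- gamma * t))%:C.
Proof.
move=> bf simple_psi gamma_le; have [Cf Cf0 fle] := bounded_opP bf.
have [[_ /(_ psi) psiE] _ _ _] := basis.
pose s k := \sum_(n < k) ip psi (phi n) *: phi n.
have s_psi : s k @[k --> \oo] --> psi.
  apply: cvg_trans psiE; apply: near_eq_cvg; near=> k.
  by rewrite /series /= big_mkord.
have [[bS _ _ _] _] := expS.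
pose r := psi - s m.
(* Zeroing the first [m] coefficients turns [s k - s m] into a sum from 0, the form needed for
   Pythagoras. *)
pose d n := if (n < m)%N then 0 else ip psi (phi n).
have sE k : (m <= k)%N -> s k - s m = \sum_(n < k) d n *: phi n.
  move=> mk; rewrite /s; pose F n := ip psi (phi n) *: phi n.
  rewrite -(big_mkord xpredT F) -(big_mkord xpredT F).
  rewrite -(big_mkord xpredT (fun n => d n *: phi n)).
  rewrite (big_cat_nat (leq0n m) mk) /= addrAC subrr add0r.
  rewrite (big_cat_nat (leq0n m) mk) /=.
  rewrite [X in X + _]big_nat [X in X + _]big1 => [|n /andP[_ nm]]; last first.
    by rewrite /d nm scale0r.
  by rewrite add0r; apply: eq_big_nat => n /andP[mn _]; rewrite /d ltnNge mn.
have Sd_le k t : (m <= k)%N -> 0 <= t ->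
    `|S t (s k - s m)| <= (expR (- gamma * t))%:C * `|s k - s m|.
  move=> mk t0; rewrite sE // linear_sum /=.
  have ->: \sum_(n < k) S t (d n *: phi n) =
      \sum_(n < k) (d n * (expR (- alpha n * t))%:C) *: phi n.
    apply: eq_bigr => n _; rewrite /d; case: ifP => _; last exact: semigroup_coef.
    by rewrite mul0r !scale0r linear0.
  rewrite -(@ler_pXn2r _ 2) ?nnegrE ?mulr_ge0 ?realc_ge0 ?expR_ge0 //.
  rewrite exprMn (orthonormal_sum_norm k (fun n => d n * (expR (- alpha n * t))%:C)).
  rewrite (orthonormal_sum_norm k d) mulr_sumr ler_sum // => n _.
  rewrite normrM exprMn mulrC; have [nm|mn] := ltnP n m.
    by rewrite /d nm normr0 expr0n mulr0 mulr0.
  rewrite ler_wpM2r ?exprn_ge0 // ler_pXn2r ?nnegrE ?normr_ge0 ?realc_ge0 ?expR_ge0 //.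
  rewrite ger0_norm ?realc_ge0 ?expR_ge0 // lecR ler_expR.
  by rewrite ler_wpM2r // lerN2 gamma_le.
have s_r : s k - s m @[k --> \oo] --> r by apply: cvgB => //; exact: cvg_cst.
have fS_r t : 0 <= t -> f (S t (s k - s m)) @[k --> \oo] --> f (S t r).
  by move=> t0; apply: (bounded_op_cvg bf); apply: (bounded_op_cvg (bS t t0)).
(* The [+ 1] allows for [|s k - s m| <= |r| + 1] at large [k], so the constant does not depend on
   [t]. *)
exists (Cf * (complex.Re `|r| + 1)) => t t0.
have -> : f (S t psi) - \sum_(n < m) ip psi (phi n) * f (phi n) * (expR (- alpha n * t))%:C
    = f (S t r).
  rewrite /r [in RHS]linearB [RHS]linearB; congr (_ - _).
  rewrite /s [in RHS]linear_sum [RHS]linear_sum; apply: eq_bigr => n _.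
  by rewrite semigroup_coef // linearZ /= mulrAC.
apply/ler_addgt0Pr => e e0.
have /cvgrPdist_le/(_ _ e0) fS_near := fS_r t t0.
have /cvgrPdist_le/(_ _ ltr01) r_near := s_r.
near \oo => k.
rewrite -(subrK (f (S t (s k - s m))) (f (S t r))) addrC.
apply: (le_trans (ler_normD _ _)); apply: lerD; last by near: k.
apply: (le_trans (fle _)); rewrite mulrAC !rmorphM -mulrA /=.
apply: ler_wpM2l; first by rewrite realc_ge0.
apply: (le_trans (Sd_le k t _ t0)); first by near: k; exact: nbhs_infty_ge.
apply: ler_wpM2l; first by rewrite realc_ge0 expR_ge0.
rewrite rmorphD rmorph1 /= -(ge0_complexE (normr_ge0 r)) -[s k - s m](subKr r).
apply: (le_trans (ler_normB _ _)); apply: lerD => //; near: k; exact: r_near.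
Unshelve. all: by end_near.
Qed.

End Sector.

(** * Coefficient of the mixture at a given rate *)

Section ModalCoefficients.
Variables (R : realType) (N : nat) (H : 'I_N -> completeNormedModType R[i]).
Variables (ip : forall k, {dot (H k) for Num.conj}) (A : forall k, unbounded_op (H k)).
Variables (S : forall k, R -> {linear H k -> H k}).
Variables (phi : forall k, nat -> H k) (alpha : 'I_N -> nat -> R).
Variables (f : forall k, {linear H k -> R[i]^o}) (w : 'I_N -> R).
Variables (psi : forall k, H k).
Hypothesis ip_norm : forall k, induces_norm (ip k).
Hypothesis selfA : forall k, self_adjoint (ip k) (A k).
Hypothesis expS : forall k, exp_semigroup (A k) (S k).
Hypothesis basis : forall k, orthonormal_eigenbasis (ip k) (A k) (phi k) (alpha k).
Hypothesis bounded_f : forall k, bounded_op (f k).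
Hypothesis w_gt0 : forall k, 0 < w k.
Hypothesis simple_psi : forall k z, active (ip k) (A k) z (psi k) ->
  simple_eigenvalue (A k) z.

Lemma modal_coefficient L (mu : 'I_L -> R) (a : 'I_L -> R[i]) :
  (forall t, 0 <= t -> \sum_(k < N) (w k)%:C * f k (S k t (psi k)) =
    \sum_(l < L) a l * (expR (- mu l * t))%:C) ->
  forall beta : R,
    \sum_(k < N) (w k)%:C * f k (eigencomponent (ip k) (A k) beta%:C (psi k)) =
    \sum_(l < L | mu l == beta) a l.
Proof.
(* Any [gamma] above [beta] would do; [m] is then a cutoff common to all sectors. *)
move=> sumE beta; pose gamma := beta + 1.
have /choice[m0 gamma_le0] k := alpha_ge_near (basis k) gamma.
pose m := (\max_(k < N) m0 k)%N.
have gamma_le k n : (m <= n)%N -> gamma <= alpha k n.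
  by move=> mn; apply/gamma_le0/(leq_trans _ mn)/leq_bigmax.
have beta_neq k n : (m <= n)%N -> beta%:C != (alpha k n)%:C :> R[i].
  move=> /(gamma_le k) le_ga; apply/eqP => -[e].
  by move: le_ga; rewrite -e leNgt ltrDl ltr01.
have /choice[C fC] k := semigroup_expansion_bound (@ip_norm k) (selfA k) (expS k)
  (basis k) (bounded_f k) (@simple_psi k) (@gamma_le k).
pose b k n := (w k)%:C * (ip k (psi k) (phi k n) * f k (phi k n)).
(* The retained modes of all sectors and the given exponentials, with opposite sign, form one sum.
   It equals the difference of two expressions for the mixture up to the tails, hence is of order
   [expR (- gamma * t)]. *)
pose c (j : 'I_N * 'I_m + 'I_L) :=
  match j with inl kn => b kn.1 kn.2 | inr l => - a l end.
pose nu (j : 'I_N * 'I_m + 'I_L) :=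
  match j with inl kn => alpha kn.1 kn.2 | inr l => mu l end.
have c0 : \sum_(j | nu j == beta) c j = 0.
  apply: (@expsum_coef_eq0 _ _ xpredT c nu (\sum_k w k * C k) gamma) => [t t0|]; last first.
    by rewrite ltrDl.
  rewrite big_sumType /=.
  rewrite -(pair_bigA _ (fun k (n : 'I_m) => b k n * (expR (- alpha k n * t))%:C)) /=.
  under [X in _ + X]eq_bigr do rewrite mulNr.
  rewrite sumrN -sumE // -sumrB mulr_suml rmorph_sum.
  apply: (le_trans (ler_norm_sum _ _ _)); apply: ler_sum => k _ /=.
  rewrite distrC -mulrA rmorphM /=.
  under eq_bigr do rewrite -mulrA.
  rewrite -mulr_sumr -mulrBr normrM ger0_norm ?realc_ge0 ?(ltW (w_gt0 k)) //.
  by apply: ler_wpM2l; rewrite ?realc_ge0 ?(ltW (w_gt0 k)) // fC.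
move: c0; rewrite big_sumType /= sumrN => /eqP; rewrite subr_eq0 => /eqP <-.
rewrite -(pair_big_dep xpredT (fun k (n : 'I_m) => alpha k n == beta)
  (fun k (n : 'I_m) => b k n)) /=.
apply: eq_bigr => k _.
rewrite (eigencomponentE (selfA k) (basis k) _ (beta_neq k)) linear_sum mulr_sumr.
apply: eq_big => n; first by rewrite eq_sym (inj_eq (@complexI R)).
by move=> _; rewrite linearZ.
Qed.

End ModalCoefficients.

(** * Matching modal families *)

Section ModalTuples.
Variable R : realType.

Lemma sum_injective_rate L (mu : 'I_L -> R) (a : 'I_L -> R[i]) l :
  injective mu -> \sum_(l' < L | mu l' == mu l) a l' = a l.
Proof. by move=> mu_inj; rewrite (eq_bigl (pred1 l)) ?big_pred1_eq // => j; apply: inj_eq. Qed.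

(** The second family has total coefficient [a l != 0] at the rate [mu l], so this rate occurs in
    it, and only once. *)
Lemma modal_pair_match L L' (mu : 'I_L -> R) (a : 'I_L -> R[i])
    (mu' : 'I_L' -> R) (a' : 'I_L' -> R[i]) :
  injective mu -> (forall l, a l != 0) -> injective mu' ->
  (forall beta, \sum_(l < L | mu l == beta) a l = \sum_(l < L' | mu' l == beta) a' l) ->
  forall l, exists l', mu' l' = mu l /\ a' l' = a l.
Proof.
move=> mu_inj a0 mu'_inj coefE l; have := coefE (mu l); rewrite sum_injective_rate //.
have [l' /eqP ml'|no] := pickP (fun l' => mu' l' == mu l).
  by rewrite -ml' sum_injective_rate // => ->; exists l'.
by rewrite big_pred0 // => al; have := a0 l; rewrite al eqxx.
Qed.

(** Matching in both directions gives mutually inverse maps, since a rate determines its index. *)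
Lemma same_modal_family L L' (mu : 'I_L -> R) (a : 'I_L -> R[i])
    (mu' : 'I_L' -> R) (a' : 'I_L' -> R[i]) :
  injective mu -> (forall l, a l != 0) ->
  injective mu' -> (forall l, a' l != 0) ->
  (forall beta, \sum_(l < L | mu l == beta) a l = \sum_(l < L' | mu' l == beta) a' l) ->
  same_family (fun l => (mu l, a l)) (fun l => (mu' l, a' l)).
Proof.
move=> mu_inj a0 mu'_inj a'0 coefE.
have /choice[s sP] := modal_pair_match mu_inj a0 mu'_inj coefE.
have /choice[s' s'P] := modal_pair_match mu'_inj a'0 mu_inj (fun b => esym (coefE b)).
exists s => [|l]; last by have [-> ->] := sP l.
exists s' => l; [apply: mu_inj | apply: mu'_inj].
- by rewrite (s'P _).1 (sP _).1.
- by rewrite (sP _).1 (s'P _).1.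
Qed.

(** A resolvent at [z] would recover the eigenvector [x] from [A x - z *: x = 0]. *)
Lemma point_spectrum_spectrum (H : completeNormedModType R[i]) (A : unbounded_op H) z :
  point_spectrum A z -> spectrum A z.
Proof.
move=> [x x0 [dx ex]] [T [_ _ TA]]; move/eqP: x0; apply.
by rewrite -(TA x dx) ex subrr linear0.
Qed.
End ModalTuples.

Theorem theorem5p4 (R : realType) (I : Type)
  (H : I -> completeNormedModType R[i])
  (ip : forall i : I, {dot (H i) for Num.conj})
  (A : forall i : I, unbounded_op (H i))
  (S : forall i : I, R -> {linear H i -> H i})
  (K : forall i j : I, {linear H j -> H i})
  (lambda : I -> I -> R)
  (phi : forall i : I, nat -> H i) (alpha : I -> nat -> R)
  (o : I) (B0 : {linear H o -> R[i]^o})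
  (N : nat) (sec : 'I_N -> I)
  (psi : forall k : 'I_N, H (sec k)) (w : 'I_N -> R)
  (L : nat) (mu : 'I_L -> R) (a : 'I_L -> R[i]) :
  (forall i, induces_norm (ip i)) ->
  (forall i, separable_space (H i)) ->
  (forall i, self_adjoint (ip i) (A i)) ->
  (forall i, positive_op (ip i) (A i)) ->
  (forall i, compact_resolvent (A i)) ->
  (forall i, exists z : R[i],
     [/\ 0 < z, spectrum (A i) z & point_spectrum (A i) z]) ->
  (forall i, exp_semigroup (A i) (S i)) ->
  (forall i j, bounded_op (K i j)) ->
  (forall i j, injective (K i j)) ->
  (forall i j, 0 < lambda i j) ->
  (forall i j k x, K i k x = K i j (K j k x)) ->
  (forall i j (t : R), 0 <= t ->
     forall x, K i j (S j t x) = S i (lambda i j * t) (K i j x)) ->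
  (forall i, orthonormal_eigenbasis (ip i) (A i) (phi i) (alpha i)) ->
  bounded_op B0 ->
  injective sec ->
  (forall k, 0 < w k) ->
  (forall k (z : R[i]), active (ip (sec k)) (A (sec k)) z (psi k) ->
     simple_eigenvalue (A (sec k)) z) ->
  (forall j k, j != k ->
     spectrum (A (sec j)) `&` spectrum (A (sec k)) = set0) ->
  let M := mixture K S B0 w psi in
  finite_exp_sum M mu a ->
  (forall L' (mu' : 'I_L' -> R) (a' : 'I_L' -> R[i]),
     finite_exp_sum M mu' a' ->
     same_family (fun l => (mu l, a l)) (fun l => (mu' l, a' l))) /\
  exists (isec : 'I_L -> 'I_N) (eig : 'I_L -> R[i]),
    [/\ (forall l,
           unique (fun p : 'I_N * R[i] =>
                     point_spectrum (A (sec p.1)) p.2 /\ (mu l)%:C = p.2)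
                  (isec l, eig l)),
        (forall L' (mu' : 'I_L' -> R) (a' : 'I_L' -> R[i])
                (isec' : 'I_L' -> 'I_N) (eig' : 'I_L' -> R[i]),
           finite_exp_sum M mu' a' ->
           (forall l, point_spectrum (A (sec (isec' l))) (eig' l) /\
                      (mu' l)%:C = eig' l) ->
           same_family (fun l => (isec l, eig l, a l))
                       (fun l => (isec' l, eig' l, a' l))) &
        ((forall k, observable_on_eigenspaces (A (sec k))
                      (fun x => B0 (K o (sec k) x))) ->
         forall (k : 'I_N) (z : R[i]),
           active (ip (sec k)) (A (sec k)) z (psi k) ->
           exists l, [/\ isec l = k, eig l = z &
             unique (fun v => op_eigenspace (A (sec k)) z v /\
                              (w k)%:C * B0 (K o (sec k) v) = a l)
                    (eigencomponent (ip (sec k)) (A (sec k)) z (psi k))])].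
Proof.
move=> ip_norm _ selfA _ _ _ expS bK _ _ _ _ basis bB sec_inj w_gt0 simple_psi
  disjoint_spectra M.
pose f k : {linear H (sec k) -> R[i]^o} := B0 \o K o (sec k).
have bf k : bounded_op (f k).
  have [C1 C10 B0_le] := bounded_opP bB.
  have [C2 C20 K_le] := bounded_opP (bK o (sec k)).
  exists (C1 * C2)%:C => x; rewrite rmorphM -mulrA.
  by apply: (le_trans (B0_le _)); rewrite ler_wpM2l ?realc_ge0.
pose P k z := eigencomponent (ip (sec k)) (A (sec k)) z (psi k).
have coefE L' (mu' : 'I_L' -> R) (a' : 'I_L' -> R[i]) : finite_exp_sum M mu' a' ->
    forall beta : R, \sum_(k < N) (w k)%:C * f k (P k beta%:C) =
      \sum_(l < L' | mu' l == beta) a' l.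
  move=> [_ _ ME]; apply: (@modal_coefficient R N (fun k => H (sec k))
    (fun k => ip (sec k)) (fun k => A (sec k)) (fun k => S (sec k))
    (fun k => phi (sec k)) (fun k => alpha (sec k)) f w psi) => // k; exact: ip_norm.
move=> Msum; have [mu_inj a_neq0 _] := Msum.
have P_eigen k z : op_eigenspace (A (sec k)) z (P k z).
  exact: eigencomponent_eigenspace (selfA _) (basis _) _ _.
have P_spec k z : P k z != 0 -> point_spectrum (A (sec k)) z.
  by move=> P0; exists (P k z).
have sector_eq j k z : point_spectrum (A (sec j)) z ->
    point_spectrum (A (sec k)) z -> j = k.
  move=> jz kz; apply/eqP; apply: contrapT => /negP jk.
  have : set0 z by rewrite -(disjoint_spectra j k jk); split; apply: point_spectrum_spectrum.
  by [].
have famE L' (mu' : 'I_L' -> R) (a' : 'I_L' -> R[i]) : finite_exp_sum M mu' a' ->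
    same_family (fun l => (mu l, a l)) (fun l => (mu' l, a' l)).
  move=> Msum'; have [mu'_inj a'_neq0 _] := Msum'.
  apply: same_modal_family => // beta.
  by rewrite -(coefE _ _ _ Msum) -(coefE _ _ _ Msum').
split=> //.
(* If [mu l] were an eigenvalue in no sector, every eigencomponent at that rate would vanish,
   forcing [a l = 0]. *)
have /choice[isec isecP] l : exists k, point_spectrum (A (sec k)) (mu l)%:C.
  apply: contrapT => no; have /eqP := a_neq0 l; apply.
  rewrite -(sum_injective_rate a l mu_inj) -(coefE _ _ _ Msum) big1 // => k _.
  have [-> | /P_spec kl] := eqVneq (P k (mu l)%:C) 0; first by rewrite linear0 mulr0.
  by case: no; exists k.
exists isec, (fun l => (mu l)%:C); split.
- move=> l; split=> [|[k z] /= [kz muz]]; first by split; first exact: isecP.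
  by rewrite -muz in kz *; rewrite (sector_eq _ _ _ (isecP l) kz).
- move=> L' mu' a' isec' eig' Msum' tagged.
  have [s s_bij sE] := famE _ _ _ Msum'; exists s => // l.
  have [mus as_] := sE l; have [spec' eigE] := tagged (s l).
  rewrite -eigE mus in spec' *; rewrite as_.
  by rewrite (sector_eq _ _ _ spec' (isecP l)).
move=> obs k z Pz; have kz := P_spec k z Pz.
(* The coefficient identity is stated for real rates, and the active eigenvalue [z] is real. *)
have [n zn _] := nonzero_eigenvalue (selfA _) (basis _) (P_eigen k z) Pz.
(* By separation, sector [k] alone contributes at the rate [z]. *)
have sumk : \sum_(l < L | mu l == alpha (sec k) n) a l = (w k)%:C * f k (P k z).
  rewrite -(coefE _ _ _ Msum) -zn (bigD1 k) //= big1 ?addr0 // => j jk.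
  have [-> | /P_spec jz] := eqVneq (P j z) 0; first by rewrite !linear0 mulr0.
  by move: jk; rewrite (sector_eq _ _ _ jz kz) eqxx.
have wk0 : (w k)%:C != 0 :> R[i] by rewrite gt_eqF // ltcR.
have fP0 : f k (P k z) != 0.
  apply: contra_neq Pz => fP0; apply: (obs k z kz); rewrite ?inE //.
  - exact: eigenspace0 (selfA _) _.
  - by rewrite !linear0; exact: fP0.
(* The contribution of sector [k] is nonzero by observability, so [z] must occur among the rates. *)
have [l /eqP mul|no] := pickP (fun l => mu l == alpha (sec k) n); last first.
  by have /eqP := sumk; rewrite big_pred0 // eq_sym mulf_eq0 (negbTE wk0) (negbTE fP0).
have zl : (mu l)%:C = z by rewrite mul zn.
move: sumk; rewrite -mul (sum_injective_rate a l mu_inj) => al.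
exists l; split=> //.
  by apply: (sector_eq _ _ (mu l)%:C) => //; rewrite zl.
split=> [|v [Ev fv]]; first by split=> //; rewrite al.
(* Once the known weight is cancelled, both vectors have the same observation, which is injective on
   the eigenspace. *)
apply: (obs k z kz); rewrite ?inE //.
by apply: (mulfI wk0); rewrite fv al.
Qed.
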